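(* Let $N>r>0$ be integers and let $A$ be a complex $N\times N$ strongly regular lower band matrix of order $r$. Then lower Green generators $p(i),q(i),a(i)$, $i=1,\dots,N-r$, $p(N-r+1)$ of the matrix $A^{-1}$ are obtained as follows. 1. By the LU procedure described in the context compute the upper triangular matrix $R$ and the matrices $L_1,\dots,L_{N-r+1}$; determine $p_L(i),q_L(i),a_L(i)$ $(i=1,\dots,N-r)$ from the partitions $$L_i=\begin{pmatrix}p_L(i)&d_L(i)\\ a_L(i)&q_L(i)\end{pmatrix},\quad i=1,\dots,N-r,$$ with $p_L(i),d_L(i),a_L(i),q_L(i)$ of sizes $1\times r,\,1\times1,\,r\times r,\,r\times1$. Let $x_k=R(k,k)$, $X_k=R(k,k+1:N)$ for $k=1,\dots,N-r$, and $Z_{N-r+1}=R(N-r+1:N,N-r+1:N)$. 2.1. Set $q(k)=q_L(k)$, $a(k)=a_L(k)$, $k=1,\dots,N-r$. 2.2. Set $p(N-r+1)=Z_{N-r+1}^{-1}L_{N-r+1}$, $P_{N-r+1}=p(N-r+1)$, and for $k=N-r,\dots,1$ compute $$p(k)=\frac1{x_k}\bigl(p_L(k)-X_kP_{k+1}a(k)\bigr),\qquad P_k=\begin{pmatrix}p(k)\\ P_{k+1}a(k)\end{pmatrix}.$$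
   Context: Notation: $M(i:j,k:l)$ denotes the submatrix of $M$ with rows $i,\dots,j$ and columns $k,\dots,l$ (a single index denotes one row or column; empty ranges give empty blocks). $I_k$ is the identity of order $k$. An $N\times N$ matrix $A$ is lower band of order $r$ if $A_{ij}=0$ for $i-j>r$. $A$ is strongly regular if all its leading principal minors are nonzero. Lower Green generators. Let $p(i)$ ($1\times r$), $q(i)$ ($r\times1$), $a(i)$ ($r\times r$), $i=1,\dots,N-r$, and an $r\times r$ matrix $p(N-r+1)$ be given. They are lower Green generators (of order $r$) of an $N\times N$ matrix $B$ if, with empty products of $a$'s equal to $I_r$: $B(i,1:r)=p(i)a(i-1)\cdots a(1)$ for $1\le i\le N-r$; $B(i,r+j)=p(i)a(i-1)\cdots a(j+1)q(j)$ for $1\le j<i\le N-r$; $B(N-r+1:N,1:r)=p(N-r+1)a(N-r)\cdots a(1)$; $B(N-r+1:N,r+j)=p(N-r+1)a(N-r)\cdots a(j+1)q(j)$ for $1\le j\le N-r$. LU procedure: (i) Set $\gamma_1=A(1,1)$, $f_1=A(2:r+1,1)/\gamma_1$, $X_1=A(1,2:N)$, $Y_1=-f_1X_1+A(2:r+1,2:N)$, $L_1=\begin{pmatrix}1&0\\ -f_1&I_r\end{pmatrix}$, $R(1,1)=\gamma_1$, $R(1,2:N)=X_1$. (ii) For $k=2,\dots,N-r$ set $\gamma_k=Y_{k-1}(1,1)$, $X_k=Y_{k-1}(1,2:N-k+1)$, $f_k=\frac1{\gamma_k}\begin{pmatrix}Y_{k-1}(2:r,1)\\ A(k+r,k)\end{pmatrix}$,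 $Z_k=\begin{pmatrix}Y_{k-1}(2:r,2:N-k+1)\\ A(k+r,k+1:N)\end{pmatrix}$, $Y_k=-f_kX_k+Z_k$, $L_k=\begin{pmatrix}1&0\\ -f_k&I_r\end{pmatrix}$, $R(k,k)=\gamma_k$, $R(k,k+1:N)=X_k$. (iii) Compute the LU factorization $Y_{N-r}=T_{N-r+1}S_{N-r+1}$ of the $r\times r$ matrix $Y_{N-r}$ with $T_{N-r+1}$ unit lower triangular and $S_{N-r+1}$ upper triangular; set $L_{N-r+1}=T_{N-r+1}^{-1}$ and $R(N-r+1:N,N-r+1:N)=S_{N-r+1}$. Entries of $R$ below the diagonal are zero. *)

(* Defs.v *)
From HB Require Import structures.
From mathcomp Require Import all_boot all_order all_algebra.
From mathcomp Require Import reals complex.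

Set Implicit Arguments.
Unset Strict Implicit.
Unset Printing Implicit Defensive.

Import GRing.Theory.
Local Open Scope ring_scope.

Section Blocks.
Variable F : fieldType.

(* The entry M(i,j) with indices counted from 1.  It is 0 outside the range
   1 <= i <= m, 1 <= j <= n; the constructions below never rely on this. *)
Definition entry m n (M : 'M[F]_(m, n)) (i j : nat) : F :=
  match i, j with
  | i'.+1, j'.+1 =>
      match insub i', insub j' with
      | Some s, Some t => M s t
      | _, _ => 0
      end
  | _, _ => 0
  end.

Lemma entry_ord m n (M : 'M[F]_(m, n)) (s : 'I_m) (t : 'I_n) :
  entry M s.+1 t.+1 = M s t.
Proof. by rewrite /entry !valK. Qed.

(* The submatrix M(i : i+p-1, k : k+q-1), indices counted from 1.  Its size
   p x q comes from the expected type, which avoids casts between sizes that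
   are equal but not convertible. *)
Definition block m n p q (M : 'M[F]_(m, n)) (i k : nat) : 'M[F]_(p, q) :=
  \matrix_(s < p, t < q) entry M (i + s)%N (k + t)%N.

(* col_mx U V with the number of rows m given by the expected type; only used
   when m = m1 + m2. *)
Definition stack m1 m2 m n (U : 'M[F]_(m1, n)) (V : 'M[F]_(m2, n)) :
  'M[F]_(m, n) := block m n (col_mx U V) 1 1.

End Blocks.

Arguments block {F m n p q} M i k.
Arguments stack {F m1 m2 m n} U V.

Section GreenGenerators.
Variables (F : fieldType) (N r : nat).
Implicit Types A B : 'M[F]_N.

Definition lower_band A : Prop :=
  forall i j : 'I_N, (j + r < i)%N -> A i j = 0.

Definition strongly_regular A : Prop :=
  forall k, (1 <= k <= N)%N -> \det (block A 1 1 : 'M[F]_k) != 0.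

(* a(i-1) a(i-2) ... a(j+1), and 1 when i <= j+1. *)
Definition aprod (a : nat -> 'M[F]_r) (i j : nat) : 'M[F]_r :=
  \big[mulmx/1%:M]_(l <- rev (index_iota j.+1 i)) a l.

(* Only the values of p, q, a at 1, ..., N-r are relevant; pN is p(N-r+1),
   which has r rows instead of one. *)
Definition lower_Green_generators (p : nat -> 'rV[F]_r) (q : nat -> 'cV[F]_r)
    (a : nat -> 'M[F]_r) (pN : 'M[F]_r) B : Prop :=
  [/\ forall i, (1 <= i <= N - r)%N ->
        (block B i 1 : 'rV[F]_r) = p i *m aprod a i 0,
      forall i j, (1 <= j < i)%N -> (i <= N - r)%N ->
        (block B i (r + j)%N : 'M[F]_1) = p i *m aprod a i j *m q j,
      (block B (N - r + 1)%N 1 : 'M[F]_r) = pN *m aprod a (N - r + 1)%N 0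
    & forall j, (1 <= j <= N - r)%N ->
        (block B (N - r + 1)%N (r + j)%N : 'cV[F]_r) =
          pN *m aprod a (N - r + 1)%N j *m q j].

End GreenGenerators.

Arguments lower_band {F N} r A.

Definition LU_factorization (F : fieldType) n (Y T S : 'M[F]_n) : Prop :=
  [/\ is_trig_mx T, forall i, T i i = 1, is_trig_mx S^T & Y = T *m S].

Section LUProcedure.
Variables (F : fieldType) (N r : nat) (A : 'M[F]_N).

(* One elimination step; Yp stands for Y_{k-1} and is ignored when k = 1. *)
Section Step.
Variables (k n : nat) (Yp : 'M[F]_(r, n)).

Definition step_gamma : F := if k == 1%N then entry A 1 1 else entry Yp 1 1.

Definition step_X : 'rV[F]_(N - k) :=
  if k == 1%N then block A 1 2 else block Yp 1 2.

Definition step_f : 'cV[F]_r :=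
  step_gamma^-1 *:
    (if k == 1%N then block A 2 1
     else stack (block Yp 2 1 : 'cV[F]_r.-1)
                (block A (k + r)%N k : 'M[F]_1)).

Definition step_Z : 'M[F]_(r, N - k) :=
  if k == 1%N then block A 2 2
  else stack (block Yp 2 2 : 'M[F]_(r.-1, N - k))
             (block A (k + r)%N k.+1 : 'rV[F]_(N - k)).

Definition step_Y : 'M[F]_(r, N - k) := - step_f *m step_X + step_Z.

End Step.

(* Meaningful for 1 <= k <= N-r only. *)
Fixpoint lu_Y (k : nat) : 'M[F]_(r, N - k) :=
  if k is k'.+1 then step_Y k'.+1 (lu_Y k') else 0.

Definition lu_gamma (k : nat) : F := step_gamma k (lu_Y k.-1).
Definition lu_X (k : nat) : 'rV[F]_(N - k) := step_X k (lu_Y k.-1).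
Definition lu_f (k : nat) : 'cV[F]_r := step_f k (lu_Y k.-1).

Definition lu_L (k : nat) : 'M[F]_(1 + r) :=
  block_mx 1%:M 0 (- lu_f k) 1%:M.

(* Y_{N-r}, which has N - (N-r) = r columns. *)
Definition lu_Ylast : 'M[F]_r := block (lu_Y (N - r)) 1 1.

(* T and S below are the factors T_{N-r+1} and S_{N-r+1} of Y_{N-r}. *)
Definition lu_Llast (T : 'M[F]_r) : 'M[F]_r := invmx T.

Definition lu_R (S : 'M[F]_r) : 'M[F]_N :=
  \matrix_(s < N, t < N)
    let k := s.+1 in let l := t.+1 in
    if (l < k)%N then 0
    else if (k <= N - r)%N then
      if l == k then lu_gamma k else entry (lu_X k) 1 (l - k)
    else entry S (k - (N - r)) (l - (N - r)).

End LUProcedure.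

Section InverseGenerators.
Variables (F : fieldType) (N r : nat) (A : 'M[F]_N) (T S : 'M[F]_r).

(* The blocks of L_k = [p_L d_L; a_L q_L] have column widths r and 1, whereas
   those defining lu_L have column widths 1 and r.  d_L plays no role below. *)
Definition part_L (k : nat) : 'M[F]_(1 + r, r + 1) :=
  castmx (erefl, addnC 1%N r) (lu_L r A k).

Definition p_L (k : nat) : 'rV[F]_r := ulsubmx (part_L k).
Definition a_L (k : nat) : 'M[F]_r := dlsubmx (part_L k).
Definition q_L (k : nat) : 'cV[F]_r := drsubmx (part_L k).

Definition R_x (k : nat) : F := entry (lu_R A S) k k.
Definition R_Zlast : 'M[F]_r := block (lu_R A S) (N - r + 1)%N (N - r + 1)%N.

Definition gen_q (k : nat) : 'cV[F]_r := q_L k.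
Definition gen_a (k : nat) : 'M[F]_r := a_L k.
Definition gen_pN : 'M[F]_r := invmx R_Zlast *m lu_Llast T.

(* p(k) computed from Pnext = P_{k+1}, which has n = N-k rows. *)
Definition step_p (k n : nat) (Pnext : 'M[F]_(n, r)) : 'rV[F]_r :=
  (R_x k)^-1 *:
    (p_L k - (block (lu_R A S) k k.+1 : 'rV[F]_n) *m Pnext *m gen_a k).

(* gen_P d is P_{N-r+1-d}, which has d + r rows. *)
Fixpoint gen_P (d : nat) : 'M[F]_(d + r, r) :=
  if d is d'.+1 then
    let k := (N - r - d')%N in
    col_mx (step_p k (gen_P d')) (gen_P d' *m gen_a k)
  else gen_pN.

Definition gen_p (k : nat) : 'rV[F]_r := step_p k (gen_P (N - r - k)).

End InverseGenerators.

(* Main.v *)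
Require Import Defs.
From mathcomp Require Import all_boot all_order all_algebra.
From mathcomp Require Import reals complex.
From mathcomp Require Import zify ring.
Import GRing.Theory.
Local Open Scope ring_scope.

Set Implicit Arguments.
Unset Strict Implicit.
Unset Printing Implicit Defensive.

(** Gaussian elimination turns [A] into its successive Schur complements
    [S_0 = A, S_1, S_2, ...], where [S_k] lives on the indices [k+1, ..., N].
    Since [A] is strongly regular, every pivot [S_k(k+1, k+1)] is nonzero:
    the leading minors of [S_k] are quotients of leading minors of [A]
    ([schur_minor_neq0]).  Since [A] is lower band of order [r], the rows of
    [S_k] with index larger than [k + r] are still rows of [A] ([schur_band]),
    so that the [r] rows kept in [Y_k] are the only ones that change; the LU
    procedure therefore just computes the first [r] rows of each [S_k]
    ([lu_YE]).

    Let [B] be the inverse of [A].  The trailing block of [B] on the indices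
    [k+1, ..., N] is the two-sided inverse of [S_k] ([schur_mulV],
    [schur_Vmul]).  Three parts of this fact give the generators.

    The first column of [B S_k = 1], below its diagonal entry, divided by the
    pivot, expresses column [k+1] of [B] below the diagonal as [- f_(k+1)]
    combined with the next [r] columns ([inverse_col]).  Now
    [a(k+1) = (-f_(k+1), e_1, ..., e_(r-1))] and [q(k+1) = e_r].  Hence right
    multiplication by [a(k+1)] moves a window of [r] consecutive columns of
    [B] one place to the left ([inverse_mul_a]), while [q(k+1)] selects its
    last column ([inverse_mul_q]); the products of the [a]'s then slide a
    window over any distance ([inverse_aprod]).

    The first row of [S_k B = 1] gives row [k+1] of [B] in terms of the rows
    below it ([inverse_row]); this is the recursion that defines [p(k+1)], and
    it shows by downward induction that [P_k] is the block of [B] whose rows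
    are [k, ..., N] and whose columns are [k, ..., k+r-1] ([gen_PE]).

    That induction starts from the inverse of the last Schur complement
    [S_(N-r) = Y_(N-r)] ([gen_pNE]).

    Any LU factorization of [Y_(N-r)] can be used; one exists because the
    elimination can be continued to the end ([lu_Ylast_LU]).  Schur complements
    are handled as functions on pairs of natural numbers, so that all of them
    keep the original row and column numbers and no sizes need to be matched. *)

(** * Schur complements *)

Section SchurComplements.
Variables (F : fieldType) (a : nat -> nat -> F).

(** Indices are counted from 1, and [schur k] is the result of eliminating
    the unknowns [1, ..., k]. *)
Fixpoint schur (k i j : nat) : F :=
  if k is l.+1 then
    schur l i j - schur l i l.+1 * (schur l l.+1 l.+1)^-1 * schur l l.+1 j
  else a i j.

Definition pivot k : F := schur k k.+1 k.+1.

Definition schur_minor k m : F :=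
  \det (\matrix_(i < m, j < m) schur k (k + i).+1 (k + j).+1).

(** Determinant of the factorization of a block matrix into a unit lower and an
    upper block triangular factor. *)
Lemma schur_minorS k m :
  pivot k != 0 -> schur_minor k m.+1 = pivot k * schur_minor k.+1 m.
Proof.
move=> nz; rewrite /schur_minor.
set M := \matrix_(i < m.+1, j < m.+1) _; set W := \matrix_(i < m, j < m) _.
pose x := \row_(j < m) schur k k.+1 (k.+1 + j).+1.
pose f := \col_(i < m) (schur k (k.+1 + i).+1 k.+1 / pivot k).
have -> : M = block_mx 1%:M 0 f 1%:M *m block_mx (pivot k)%:M x 0 W :> 'M_(1 + m).
  rewrite mulmx_block !mul1mx !mul0mx !addr0.
  rewrite -[M in LHS](@submxK _ 1 m 1 m); congr block_mx; apply/matrixP=> i j.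
  - by rewrite !ord1 !mxE /= !addn0 mulr1n.
  - by rewrite !ord1 !mxE /= addn0 add1n addnS addSn.
  - rewrite !ord1 !mxE big_ord1 !mxE /= mulr1n addn0 add1n addnS addSn.
    by rewrite divfK.
  - rewrite !mxE big_ord1 !mxE /= !add1n !addnS !addSn.
    by rewrite /pivot addrC subrK.
by rewrite (@det_mulmx _ (1 + m)) (@det_lblock _ 1 m) (@det_ublock _ 1 m) !det1 !mul1r det_scalar1.
Qed.

Lemma pivot_minor k : pivot k = schur_minor k 1.
Proof.
rewrite /schur_minor (mx11_scalar (\matrix_(_, _) _)) det_scalar1 mxE /=.
by rewrite addn0.
Qed.

(** Leading minors of a Schur complement are quotients of leading minors of
    the original matrix, so strong regularity passes from one elimination
    step to the next. *)
Lemma schur_minor_neq0 n :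
    (forall m, (m < n)%N -> schur_minor 0 m.+1 != 0) ->
  forall k m, (k + m < n)%N -> schur_minor k m.+1 != 0.
Proof.
move=> minors; elim=> [|k IH] m lt_n; first exact: minors.
have piv : pivot k != 0 by rewrite pivot_minor IH //; lia.
have := IH m.+1 ltac:(lia).
by rewrite schur_minorS // mulf_eq0 negb_or => /andP[].
Qed.

Lemma schur_eliminated n :
    (forall k, (k < n)%N -> pivot k != 0) ->
  forall k i j, (k <= n)%N ->
    (0 < i <= k)%N || (0 < j <= k)%N -> schur k i j = 0.
Proof.
move=> piv; elim=> [|k IH] i j lt_k; first by lia.
have {}piv := piv k lt_k; rewrite /pivot in piv.
have [->|ni] := eqVneq i k.+1; first by rewrite /= divff // mul1r subrr.
have [->|nj] := eqVneq j k.+1; first by rewrite /= divfK // subrr.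
case/orP => le_k /=.
  by rewrite !(IH i) ?mul0r ?subr0 //; lia.
by rewrite !(IH _ j) ?mulr0 ?subr0 //; lia.
Qed.

(** Each elimination step subtracts one rank-one matrix; together with
    [schur_eliminated] this is the LU factorization of a Schur complement. *)
Lemma schur_telescope m n i j : (m <= n)%N ->
  schur m i j = schur n i j +
    \sum_(m <= l < n) schur l i l.+1 * (pivot l)^-1 * schur l l.+1 j.
Proof.
elim: n => [|n IH]; first by rewrite leqn0 => /eqP ->; rewrite big_geq // addr0.
rewrite leq_eqVlt => /orP[/eqP ->|lt_mn]; first by rewrite big_geq ?addr0.
by rewrite big_nat_recr //= IH //= /pivot; ring.
Qed.

(** The elimination multiplier of row [i] vanishes until the band reaches that
    row. *)
Lemma schur_band r :
    (forall i j, (j + r < i)%N -> a i j = 0) ->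
  forall k i j, (k + r < i)%N -> schur k i j = a i j.
Proof.
move=> band; elim=> [//|k IH] i j lt_i /=.
by rewrite !(IH i) ?(band i k.+1) ?mul0r ?subr0 //; lia.
Qed.

Section Inverse.
Variables (n : nat) (b : nat -> nat -> F).
Hypothesis piv : forall k, (k < n)%N -> pivot k != 0.

(** The row of the new pivot is orthogonal to the later columns of [b], hence
    subtracting a multiple of it from the other rows keeps their products with
    [b]; the first term of the sum can then be dropped, because the first
    column has been eliminated. *)
Lemma schur_mulV :
    (forall i j, (0 < i <= n)%N -> (0 < j <= n)%N ->
       \sum_(1 <= l < n.+1) a i l * b l j = (i == j)%:R) ->
  forall k i j, (k < i <= n)%N -> (k < j <= n)%N ->
    \sum_(k.+1 <= l < n.+1) schur k i l * b l j = (i == j)%:R.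
Proof.
move=> ab; elim=> [|k IH] i j lt_i lt_j; first exact: ab.
have rowi := IH i j ltac:(lia) ltac:(lia).
have /eqP rowk := IH k.+1 j ltac:(lia) ltac:(lia).
rewrite big_ltn in rowi; last lia.
have ne_kj : (k.+1 == j) = false by lia.
rewrite ne_kj big_ltn in rowk; last lia.
rewrite addrC addr_eq0 in rowk; move/eqP: rowk => rowk.
rewrite -rowi /= (eq_bigr (fun l => schur k i l * b l j -
  schur k i k.+1 * (pivot k)^-1 * (schur k k.+1 l * b l j))); last first.
  by move=> l _; rewrite /pivot; ring.
rewrite sumrB -mulr_sumr.
have -> : \sum_(k.+2 <= l < n.+1) schur k k.+1 l * b l j = - (pivot k * b k.+1 j).
  by [].
by field; apply: piv; lia.
Qed.

Lemma schur_Vmul :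
    (forall i j, (0 < i <= n)%N -> (0 < j <= n)%N ->
       \sum_(1 <= l < n.+1) b i l * a l j = (i == j)%:R) ->
  forall k i j, (k < i <= n)%N -> (k < j <= n)%N ->
    \sum_(k.+1 <= l < n.+1) b i l * schur k l j = (i == j)%:R.
Proof.
move=> ba; elim=> [|k IH] i j lt_i lt_j; first exact: ba.
have colj := IH i j ltac:(lia) ltac:(lia).
have /eqP colk := IH i k.+1 ltac:(lia) ltac:(lia).
rewrite big_ltn in colj; last lia.
have ne_ik : (i == k.+1) = false by lia.
rewrite ne_ik big_ltn in colk; last lia.
rewrite addrC addr_eq0 in colk; move/eqP: colk => colk.
rewrite -colj /= (eq_bigr (fun l => b i l * schur k l j -
  (b i l * schur k l k.+1) * ((pivot k)^-1 * schur k k.+1 j))); last first.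
  by move=> l _; rewrite /pivot; ring.
rewrite sumrB -mulr_suml.
have -> : \sum_(k.+2 <= l < n.+1) b i l * schur k l k.+1 = - (b i k.+1 * pivot k).
  by [].
by field; apply: piv; lia.
Qed.

End Inverse.
End SchurComplements.

(** * Entries of blocks and products *)

Section Entries.
Variable F : fieldType.

Lemma entryE m n (M : 'M[F]_(m, n)) i j (lt_i : (i < m)%N) (lt_j : (j < n)%N) :
  entry M i.+1 j.+1 = M (Ordinal lt_i) (Ordinal lt_j).
Proof. by rewrite -entry_ord. Qed.

Lemma entry_block m n p q (M : 'M[F]_(m, n)) i k s t :
    (s < p)%N -> (t < q)%N ->
  entry (block M i k : 'M_(p, q)) s.+1 t.+1 = entry M (i + s) (k + t).
Proof. by move=> lt_s lt_t; rewrite (entryE _ lt_s lt_t) mxE. Qed.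

Lemma entry_stack m1 m2 m n (U : 'M[F]_(m1, n)) (V : 'M[F]_(m2, n)) s t :
    m = (m1 + m2)%N -> (s < m)%N -> (t < n)%N ->
  entry (stack U V : 'M_(m, n)) s.+1 t.+1 =
    if (s < m1)%N then entry U s.+1 t.+1 else entry V (s - m1).+1 t.+1.
Proof.
move=> -> lt_s lt_t; rewrite entry_block // !add1n (entryE _ lt_s lt_t).
case: ltnP => h.
  have -> : Ordinal lt_s = lshift m2 (Ordinal h) by apply: val_inj.
  by rewrite col_mxEu (entryE _ h lt_t).
have lt_s2 : (s - m1 < m2)%N by lia.
have -> : Ordinal lt_s = rshift m1 (Ordinal lt_s2) by apply: val_inj => /=; lia.
by rewrite col_mxEd (entryE _ lt_s2 lt_t).
Qed.

Lemma entry_mul1 n (A B : 'M[F]_n) : A *m B = 1%:M ->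
  forall i j, (0 < i <= n)%N -> (0 < j <= n)%N ->
    \sum_(1 <= l < n.+1) entry A i l * entry B l j = (i == j)%:R.
Proof.
move=> AB [//|i] [//|j] lt_i lt_j.
rewrite big_add1 succnK big_mkord eqSS.
transitivity ((A *m B) (Ordinal lt_i) (Ordinal lt_j)); last by rewrite AB mxE.
rewrite mxE; apply: eq_bigr => l _.
by rewrite (entryE _ lt_i (ltn_ord l)) (entryE _ (ltn_ord l) lt_j);
  congr (A _ _ * B _ _); apply: val_inj.
Qed.

Lemma sum_nat_shift (f : nat -> F) k n :
  \sum_(k <= l < k + n) f l = \sum_(t < n) f (k + t)%N.
Proof.
rewrite -{1}[k]add0n big_addn addKn big_mkord.
by apply: eq_bigr => t _; rewrite addnC.
Qed.

End Entries.

(** * The LU procedure computes Schur complements *)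

Section InverseGreenGenerators.
Variables (F : fieldType) (N r : nat) (A : 'M[F]_N).
Hypothesis r_bounds : (0 < r < N)%N.
Hypothesis regular : strongly_regular A.
Hypothesis band : lower_band r A.

Local Notation M := (N - r)%N.
Local Notation S := (schur (entry A)).

Lemma r_gt0 : (0 < r)%N.
Proof. by case/andP: r_bounds. Qed.

Lemma block_full : block A 1 1 = A.
Proof. by apply/matrixP=> i j; rewrite mxE !add1n entry_ord. Qed.

Lemma regular_unit : A \in unitmx.
Proof. by rewrite unitmxE unitfE -[A]block_full regular //; lia. Qed.

Lemma schur_minor_regular k m :
  (k + m < N)%N -> schur_minor (entry A) k m.+1 != 0.
Proof.
apply: schur_minor_neq0 => {k}{}m lt_m.
have := @regular m.+1 lt_m; rewrite /schur_minor.
by congr (\det _ != 0); apply/matrixP=> i j; rewrite !mxE.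
Qed.

Lemma pivot_neq0 k : (k < N)%N -> pivot (entry A) k != 0.
Proof. by move=> lt_k; rewrite pivot_minor schur_minor_regular ?addn0. Qed.

Lemma entry_band i j : (j + r < i)%N -> entry A i j = 0.
Proof.
case: i j => [|i] [|j] // lt_i.
rewrite /entry; case: insubP => // s _ es; case: insubP => // t _ et.
by move: es et => /= es et; apply: band; rewrite es et.
Qed.

(** The window of step [k+1] consists of the [r] rows of [Y_k] and one fresh
    row of [A]; by the band condition that row is the corresponding row of
    [S_k].  For [k = 0] the window is read from [A] directly, hence the guard
    on the hypothesis. *)
Lemma lu_windowE k : (k < M)%N ->
    ((0 < k)%N -> forall s t, (s < r)%N -> (t < N - k)%N ->
       entry (lu_Y r A k) s.+1 t.+1 = S k (k + s).+1 (k + t).+1) ->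
  [/\ lu_gamma r A k.+1 = pivot (entry A) k,
      forall t, lu_X r A k.+1 0 t = S k k.+1 (k + t).+2,
      forall s, lu_f r A k.+1 s 0 =
        (pivot (entry A) k)^-1 * S k (k + s).+2 k.+1
    & forall s t, step_Z A k.+1 (lu_Y r A k) s t = S k (k + s).+2 (k + t).+2].
Proof.
move=> lt_k hY.
have rE : r = (r.-1 + 1)%N by have := r_gt0; lia.
have sb : forall j, S k (k + r).+1 j = entry A (k + r).+1 j.
  by move=> j; apply: schur_band => //; exact: entry_band.
have hg : lu_gamma r A k.+1 = pivot (entry A) k.
  rewrite /lu_gamma /step_gamma /pivot.
  case: k lt_k hY {sb} => [//|k] lt_k /(_ isT) hY.
  by rewrite [LHS](hY 0%N 0%N) ?addn0 //; [exact: r_gt0|lia].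
split=> //.
- move=> t; have := ltn_ord t => lt_t; rewrite /lu_X /step_X.
  case: k lt_k hY t lt_t {sb hg} => [|k] lt_k; first by move=> _ t _; rewrite mxE.
  move=> /(_ isT) hY t lt_t.
  rewrite mxE (hY 0%N t.+1); [|exact: r_gt0|lia].
  by rewrite addn0 addnS.
- move=> s; have := ltn_ord s => lt_s; rewrite /lu_f /step_f -/(lu_gamma r A k.+1) hg.
  rewrite mxE; congr (_ * _).
  case: k lt_k hY sb {hg} => [|k] lt_k; first by move=> _ _; rewrite mxE.
  move=> /(_ isT) hY sb; rewrite -[LHS]/(stack _ _ s 0) -[LHS]entry_ord entry_stack //.
  case: ltnP => h.
    rewrite entry_block // (hY s.+1 0%N); [|lia..].
    by rewrite addn0 addnS.
  have -> : (s - r.-1 = 0)%N by lia.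
  rewrite entry_block // !addn0 addSn -sb.
  by congr (S _ _ _); lia.
- move=> s t; have := ltn_ord s => lt_s; have := ltn_ord t => lt_t.
  rewrite /step_Z.
  case: k lt_k hY sb t lt_t {hg} => [|k] lt_k.
    by move=> _ _ t _; rewrite mxE.
  move=> /(_ isT) hY sb t lt_t; rewrite -[LHS]/(stack _ _ s t) -[LHS]entry_ord entry_stack //.
  case: ltnP => h.
    rewrite entry_block // (hY s.+1 t.+1); [|lia..].
    by rewrite !addnS.
  have -> : (s - r.-1 = 0)%N by lia.
  rewrite entry_block // !addn0 addSn -sb.
  by congr (S _ _ _); lia.
Qed.

Lemma lu_YE k : (0 < k <= M)%N -> forall s t, (s < r)%N -> (t < N - k)%N ->
  entry (lu_Y r A k) s.+1 t.+1 = S k (k + s).+1 (k + t).+1.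
Proof.
elim: k => [//|k IH] lt_k s t lt_s lt_t.
have [|k_gt0|_ hX hf hZ] := @lu_windowE k; [lia|by apply: IH; lia|].
rewrite (entryE _ lt_s lt_t) /= /step_Y mxE [X in X + _]mxE big_ord1.
rewrite -/(lu_X r A k.+1) -/(lu_f r A k.+1) [in X in X * _]mxE hf hX hZ /= !addSn.
by rewrite /pivot; ring.
Qed.

Lemma lu_stepE k : (k < M)%N ->
  [/\ lu_gamma r A k.+1 = pivot (entry A) k,
      forall t, lu_X r A k.+1 0 t = S k k.+1 (k + t).+2
    & forall s, lu_f r A k.+1 s 0 =
        (pivot (entry A) k)^-1 * S k (k + s).+2 k.+1].
Proof.
move=> lt_k; have [//|k_gt0|-> hX hf _] := @lu_windowE k; last by split.
by apply: lu_YE; lia.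
Qed.

Lemma lu_YlastE (s t : 'I_r) : lu_Ylast r A s t = S M (M + s).+1 (M + t).+1.
Proof.
have lt_s := ltn_ord s; have lt_t := ltn_ord t.
by rewrite mxE !add1n lu_YE //; lia.
Qed.

Lemma lu_Ylast_unit : lu_Ylast r A \in unitmx.
Proof.
rewrite unitmxE unitfE.
have := @schur_minor_regular M r.-1 ltac:(lia).
have -> : r.-1.+1 = r by lia.
rewrite /schur_minor; congr (\det _ != 0).
by apply/matrixP => i j; rewrite lu_YlastE mxE.
Qed.

(** Continuing the elimination on [Y_(N-r)] yields the factors: the multipliers
    form the columns of [T], the pivot rows the rows of [U]. *)
Lemma lu_Ylast_LU : exists T U, LU_factorization (lu_Ylast r A) T U.
Proof.
exists (\matrix_(s < r, t < r)
  (S (M + t) (M + s).+1 (M + t).+1 * (pivot (entry A) (M + t))^-1)).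
exists (\matrix_(s < r, t < r) S (M + s) (M + s).+1 (M + t).+1).
split.
- apply/is_trig_mxP => s t lt_st; have := ltn_ord t => lt_t.
  rewrite mxE (schur_eliminated pivot_neq0) ?mul0r //; lia.
- move=> s; have := ltn_ord s => lt_s.
  by rewrite mxE divff // pivot_neq0 //; lia.
- apply/is_trig_mxP => s t lt_st; have := ltn_ord t => lt_t.
  by rewrite !mxE (schur_eliminated pivot_neq0) //; lia.
apply/matrixP=> s t; have := ltn_ord s => lt_s; have := ltn_ord t => lt_t.
rewrite lu_YlastE mxE (@schur_telescope _ _ _ N); last lia.
rewrite (schur_eliminated pivot_neq0) ?add0r //; last lia.
rewrite -{2}[N](@subnK r) ?sum_nat_shift; last lia.
by apply: eq_bigr => l _; rewrite !mxE.
Qed.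

(** * Sliding column windows of the inverse *)

Local Notation B := (invmx A).

Lemma inverse_row k j : (k < M)%N -> (k < j <= N)%N ->
  pivot (entry A) k * entry B k.+1 j +
    \sum_(k.+2 <= l < N.+1) S k k.+1 l * entry B l j = (k.+1 == j)%:R.
Proof.
move=> lt_k lt_j.
rewrite -(schur_mulV pivot_neq0 (entry_mul1 (mulmxV regular_unit)) (k := k)) //;
  last lia.
by rewrite [RHS]big_ltn //; lia.
Qed.

(** The sum stops after [r] terms because column [k+1] of [S_k] vanishes below
    row [k+1+r]. *)
Lemma inverse_col k i : (k < M)%N -> (k.+1 < i <= N)%N ->
  entry B i k.+1 =
    - \sum_(t < r) entry B i (k.+2 + t) * lu_f r A k.+1 t 0.
Proof.
move=> lt_k lt_i; have piv : pivot (entry A) k != 0 by apply: pivot_neq0; lia.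
have := schur_Vmul pivot_neq0 (entry_mul1 (mulVmx regular_unit)) (k := k)
  (i := i) (j := k.+1) ltac:(lia) ltac:(lia).
have -> : (i == k.+1) = false by lia.
rewrite big_ltn; last lia.
rewrite (@big_cat_nat _ _ _ (k.+2 + r)) /=; [|lia..].
rewrite [X in _ + (_ + X)]big_nat_cond [X in _ + (_ + X)]big1 => [|l lt_l]; last first.
  rewrite (schur_band entry_band) ?entry_band ?mulr0 //; lia.
rewrite addr0 sum_nat_shift => /eqP; rewrite addr_eq0 => /eqP col0.
apply: (mulIf piv); rewrite [LHS]col0 mulNr mulr_suml; congr (- _).
apply: eq_bigr => t _; have [_ _ ->] := lu_stepE lt_k.
by rewrite -mulrA mulrAC mulVf // mul1r !addSn.
Qed.

Lemma lu_LE k (i j : 'I_r.+1) : lu_L r A k i j =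
  if j == 0%N :> nat then (if unlift ord0 i is Some s then - lu_f r A k s 0 else 1)
  else (i == j)%:R.
Proof.
have l0 : lshift r (0 : 'I_1) = ord0 :> 'I_r.+1 by apply: val_inj.
have rS (s : 'I_r) : rshift 1 s = lift ord0 s :> 'I_r.+1 by apply: val_inj.
rewrite /lu_L; case: (unliftP ord0 i) => [s|] ->; case: (unliftP ord0 j) => [t|] ->;
  rewrite -?rS -?rS -?l0 -?l0.
- by rewrite block_mxEdr mxE (inj_eq (@rshift_inj 1 r)).
- by rewrite block_mxEdl mxE.
- by rewrite block_mxEur mxE -val_eqE.
- by rewrite block_mxEul mxE.
Qed.

Lemma p_LE k t : p_L r A k 0 t = (t == 0%N :> nat)%:R.
Proof.
rewrite mxE mxE /part_L castmxE cast_ord_id lu_LE /=.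
rewrite (_ : lshift r 0 = ord0) ?unlift_none; last exact: val_inj.
by case: (eqVneq (t : nat) 0%N) => // ne; rewrite -val_eqE /= eq_sym (negbTE ne).
Qed.

Lemma a_LE k s t : a_L r A k s t =
  if t == 0%N :> nat then - lu_f r A k s 0 else (s.+1 == t)%:R.
Proof.
rewrite mxE mxE /part_L castmxE cast_ord_id lu_LE /=.
by rewrite (_ : rshift 1 s = lift ord0 s) ?liftK; last exact: val_inj.
Qed.

Lemma q_LE k s : q_L r A k s 0 = (s.+1 == r)%:R.
Proof.
rewrite mxE mxE /part_L castmxE cast_ord_id lu_LE /=.
by rewrite addn0 ifN ?lt0n_neq0 ?r_gt0 // -val_eqE /= add1n addn0.
Qed.

(** The first column of [a_L] brings in the column of [B] to the left of the
    window; its other columns shift the window by one place. *)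
Lemma inverse_mul_a n i k : (k < M)%N -> (k.+1 < i)%N -> (i + n <= N.+1)%N ->
  (block B i k.+2 : 'M_(n, r)) *m a_L r A k.+1 = block B i k.+1.
Proof.
move=> lt_k lt_i le_n; apply/matrixP => s t.
have := ltn_ord s => lt_s; have := ltn_ord t => lt_t.
rewrite mxE [RHS]mxE; case: (posnP t) => [t0|t_gt0].
  rewrite t0 addn0 inverse_col //; last lia.
  rewrite -sumrN; apply: eq_bigr => l _.
  by rewrite mxE a_LE t0 eqxx mulrN.
have lt_t1 : (t.-1 < r)%N by lia.
rewrite (bigD1 (Ordinal lt_t1)) //= big1 ?addr0 => [|l ne_l].
  by rewrite mxE a_LE /= gtn_eqF // prednK // eqxx mulr1; congr entry; lia.
rewrite a_LE gtn_eqF // (_ : (l.+1 == t) = false) ?mulr0 //.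
by move: ne_l; rewrite -val_eqE /=; lia.
Qed.

Lemma inverse_mul_q n i k :
  (block B i k.+2 : 'M_(n, r)) *m q_L r A k.+1 = block B i (r + k.+1).
Proof.
have rg := r_gt0; apply/matrixP => s t; rewrite ord1 mxE [RHS]mxE.
have lt_r1 : (r.-1 < r)%N by lia.
rewrite (bigD1 (Ordinal lt_r1)) //= big1 ?addr0 => [|l ne_l].
  by rewrite mxE q_LE /= prednK // eqxx mulr1; congr entry; lia.
rewrite q_LE (_ : (l.+1 == r) = false) ?mulr0 //.
by move: ne_l; rewrite -val_eqE /=; lia.
Qed.

Lemma aprodS (a : nat -> 'M[F]_r) i j : (j.+1 < i)%N ->
  aprod a i j.+1 *m a j.+1 = aprod a i j.
Proof.
move=> lt_j; rewrite /aprod.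
have -> : index_iota j.+1 i = j.+1 :: index_iota j.+2 i.
  by rewrite /index_iota (_ : (i - j.+1 = (i - j.+2).+1)%N); last lia.
rewrite rev_cons; elim: (rev _) => [|l s IHs]; first by rewrite big_nil big_seq1_id mul1mx mulmx1.
by rewrite big_cons -mulmxA IHs big_cons.
Qed.

Lemma aprod_nil (a : nat -> 'M[F]_r) i : aprod a i.+1 i = 1%:M.
Proof. by rewrite /aprod /index_iota subnn big_nil. Qed.

Lemma inverse_aprod n i j : (j < i)%N -> (i <= M.+1)%N -> (i + n <= N.+1)%N ->
  (block B i i : 'M_(n, r)) *m aprod (gen_a r A) i j = block B i j.+1.
Proof.
move=> lt_j le_i le_n; have [d] := ubnP (i - j); elim: d j lt_j => // d IH j lt_j lt_d.
have [->|lt_j1] : i = j.+1 \/ (j.+1 < i)%N by lia.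
  by rewrite aprod_nil mulmx1.
rewrite -aprodS // mulmxA IH; [|lia..].
by rewrite inverse_mul_a //; lia.
Qed.

(** * The generators of the inverse *)

Section LastFactorization.
Variables T U : 'M[F]_r.
Hypothesis TU : LU_factorization (lu_Ylast r A) T U.

Lemma lu_T_unit : T \in unitmx.
Proof.
case: TU => trT T1 _ _.
by rewrite unitmxE det_trig // big1 ?unitr1.
Qed.

Lemma lu_S_unit : U \in unitmx.
Proof.
case: TU => _ _ _ Y; have := lu_Ylast_unit.
by rewrite Y unitmx_mul => /andP[].
Qed.

Lemma R_xE k : (k < M)%N -> R_x A U k.+1 = pivot (entry A) k.
Proof.
move=> lt_k; have lt_N : (k < N)%N by lia.
rewrite /R_x (entryE _ lt_N lt_N) mxE /= ltnn lt_k eqxx.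
by have [->] := lu_stepE lt_k.
Qed.

Lemma R_XE k l : (k < M)%N -> (k.+1 < l <= N)%N ->
  entry (lu_R A U) k.+1 l = S k k.+1 l.
Proof.
move=> lt_k; case: l => // l lt_l.
have lt_kN : (k < N)%N by lia.
have lt_lN : (l < N)%N by lia.
rewrite (entryE _ lt_kN lt_lN) mxE /= lt_k ifN ?gtn_eqF //; [|lia..].
have lt_t : (l - k.+1 < N - k.+1)%N by lia.
have [_ hX _] := lu_stepE lt_k.
have -> : (l.+1 - k.+1 = (l - k.+1).+1)%N by lia.
have := hX (Ordinal lt_t); rewrite -[lu_X _ _ _ _ _]entry_ord /= => ->.
by congr (S _ _ _); lia.
Qed.

Lemma R_ZlastE : R_Zlast A U = U.
Proof.
case: TU => _ _ /is_trig_mxP trU _.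
apply/matrixP=> s t; have := ltn_ord s => lt_s; have := ltn_ord t => lt_t.
rewrite mxE addn1 !addSn.
have lt_sN : (M + s < N)%N by lia.
have lt_tN : (M + t < N)%N by lia.
rewrite (entryE _ lt_sN lt_tN) mxE /= ltnS ltn_add2l.
case: ltnP => [lt_ts|_]; first by have := trU t s lt_ts; rewrite mxE.
rewrite ifN -?ltnNge ?ltnS ?leq_addr //.
by rewrite -!addnS !addKn entry_ord.
Qed.

(** Both sides are the inverse of [Y_(N-r)]: the left one through its
    factorization, the right one because [Y_(N-r)] is a Schur complement of
    [A]. *)
Lemma gen_pNE : gen_pN A T U = block B M.+1 M.+1.
Proof.
rewrite /gen_pN R_ZlastE /lu_Llast.
have TU1 : lu_Ylast r A *m (block B M.+1 M.+1 : 'M_r) = 1%:M.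
  apply/matrixP=> s t; have := ltn_ord s => lt_s; have := ltn_ord t => lt_t.
  rewrite !mxE -val_eqE /= -(eqn_add2l M.+1).
  rewrite -(schur_mulV pivot_neq0 (entry_mul1 (mulmxV regular_unit)) (k := M));
    [|lia..].
  have -> : N.+1 = (M.+1 + r)%N by lia.
  rewrite sum_nat_shift; apply: eq_bigr => l _.
  by rewrite lu_YlastE mxE !addSn.
case: TU => _ _ _ Y; move: TU1; rewrite Y -mulmxA => TU1.
by rewrite -[RHS](mulKmx lu_S_unit) -[in RHS](mulKmx lu_T_unit (U *m _)) TU1 mulmx1.
Qed.

(** The recursion for [p(k+1)] is row [k+1] of [S_k B = 1], solved for row
    [k+1] of [B]. *)
Lemma step_pE k n : (k < M)%N -> (k.+1 + n = N)%N ->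
  step_p A U k.+1 (block B k.+2 k.+2 : 'M_(n, r)) = block B k.+1 k.+1.
Proof.
move=> lt_k eq_n; have piv : pivot (entry A) k != 0 by apply: pivot_neq0; lia.
rewrite /step_p R_xE // -mulmxA inverse_mul_a //; last lia.
apply/matrixP=> s t; have := ltn_ord t => lt_t.
rewrite ord1 mxE [X in _ * X]mxE [X in _ + X]mxE [X in _ - X]mxE p_LE [RHS]mxE addn0.
apply: (mulfI piv); rewrite mulVKf //.
have -> : (t == 0%N :> nat) = (k.+1 == k.+1 + t)%N by lia.
rewrite -(@inverse_row k) //; last lia.
have -> : N.+1 = (k.+2 + n)%N by lia.
rewrite sum_nat_shift; apply/eqP; rewrite subr_eq; apply/eqP; congr (_ + _).
apply: eq_bigr => l _; have := ltn_ord l => lt_l.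
by rewrite !mxE addn0 R_XE //; lia.
Qed.

Lemma gen_PE d : (d <= M)%N -> gen_P A T U d = block B (M - d).+1 (M - d).+1.
Proof.
elim: d => [_|d IH lt_d]; first by rewrite subn0 /= gen_pNE.
rewrite /= IH; last lia.
have -> : (M - d = (M - d.+1).+1)%N by lia.
rewrite step_pE ?inverse_mul_a; [|lia..].
(* The rows are counted as 1 + (d + r), the size at which col_mx is built. *)
apply/(@matrixP _ (1 + (d + r)) r)=> s t; have [i|i] := split_ordP s => ->.
  by rewrite col_mxEu ord1 !mxE addn0.
by rewrite col_mxEd !mxE addnA addn1.
Qed.

Lemma gen_pE k : (k < M)%N -> gen_p A T U k.+1 = block B k.+1 k.+1.
Proof.
move=> lt_k; rewrite /gen_p gen_PE; last lia.
have -> : (M - (M - k.+1) = k.+1)%N by lia.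
by rewrite step_pE //; lia.
Qed.

Lemma inverse_generators :
  lower_Green_generators (gen_p A T U) (gen_q r A) (gen_a r A) (gen_pN A T U) B.
Proof.
rewrite /lower_Green_generators gen_pNE addn1; split.
- case=> // i lt_i; rewrite gen_pE // inverse_aprod //; lia.
- move=> [|i] [|j] // lt_j lt_i.
  rewrite gen_pE // inverse_aprod ?inverse_mul_q //; lia.
- by rewrite inverse_aprod //; lia.
- case=> // j lt_j; rewrite inverse_aprod ?inverse_mul_q //; lia.
Qed.

End LastFactorization.
End InverseGreenGenerators.

Theorem theorem5p6 (R : realType) (N r : nat) (A : 'M[R[i]]_N) :
  (0 < r < N)%N -> strongly_regular A -> lower_band r A ->
  [/\ A \in unitmx,
      forall k, (1 <= k <= N - r)%N -> lu_gamma r A k != 0,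
      exists T S : 'M[R[i]]_r, LU_factorization (lu_Ylast r A) T S
    & forall T S : 'M[R[i]]_r, LU_factorization (lu_Ylast r A) T S ->
        [/\ T \in unitmx,
            forall k, (1 <= k <= N - r)%N -> R_x A S k != 0,
            R_Zlast A S \in unitmx
          & lower_Green_generators (gen_p A T S) (gen_q r A) (gen_a r A)
              (gen_pN A T S) (invmx A)]].
Proof.
move=> r_bounds regular band.
have piv k : (k < N - r)%N -> pivot (entry A) k != 0.
  by move=> lt_k; apply: (pivot_neq0 regular); lia.
split.
- exact: (regular_unit r_bounds regular).
- by case=> // k lt_k; have [-> _ _] := lu_stepE r_bounds band lt_k; apply: piv.
- exact: (lu_Ylast_LU r_bounds regular band).
move=> T S TS; split.
- exact: lu_T_unit TS.
- by case=> // k lt_k; rewrite (R_xE r_bounds band) // piv.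
- rewrite (R_ZlastE r_bounds TS); exact: lu_S_unit TS.
- exact: inverse_generators TS.
Qed.
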